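(* Let $n\ge3$. The zeta map $\zeta_D:\mathcal L^\bullet_{n-1,n}\to\mathcal B^\bullet_{2n-1}$ is a bijection from signed lattice paths to signed ballot paths.
   Context: A signed lattice path is a word in $\{N,E\}$ with $n-1$ East steps and $n$ North steps, except that if its first step is East, this step is replaced by $E^+$ or $E^-$ (signed steps count as East steps); the set is $\mathcal L^\bullet_{n-1,n}$, and $\epsilon(\pi)=-1$ if $\pi$ contains $E^-$, else $1$. A signed ballot path is a word of length $2n-1$ in $\{N,E\}$ all of whose prefixes have at least as many $N$'s as $E$'s, except that if its $n$-th North step is immediately followed by an East step, this East step is replaced by $E^+$ or $E^-$; the set is $\mathcal B^\bullet_{2n-1}$. For $\pi\in\mathcal L^\bullet_{n-1,n}$ let $\pi_i$ be the number of East steps before the $i$-th North step; $\lambda_1=\epsilon(\pi)\pi_1$, $\lambda_i=\pi_i$ ($1<i<n$), $\lambda_n=2\pi_n-\pi_{n-1}$ if $\pi_1+\dots+\pi_{n-2}$ is even and $2n-1-2\pi_n+\pi_{n-1}$ if odd. Area vector: $\mu=(\lambda_1,\lambda_2-1,\dots,\lambda_{n-1}-(n-2),\lambda_n-(n-1))$ if $n-1\equiv0,3\pmod4$, and $\mu=(-\lambda_1,\lambda_2-1,\dots,\lambda_{n-1}-(n-2),n-\lambda_n)$ if $n-1\equiv1,2\pmod4$. For $a\in\mathbb Z^n$, $j\ge0$: $\overrightarrow{S}^+_j(a)$ reads $a$ left to right writing $N$ for entries $j$ and $E$ for entries $j+1$; $\overleftarrow{S}^+_j(a)$ reads right to left;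 $\overrightarrow{S}^-_j,\overleftarrow{S}^-_j$ likewise with $N$ for $-j$ and $E$ for $-j-1$. $\zeta_D(\pi)$ is obtained from $\overleftarrow{S}^-_{2n-1}(\mu)\overrightarrow{S}^+_{2n-1}(\mu)\cdots\overleftarrow{S}^-_0(\mu)\overrightarrow{S}^+_0(\mu)$ by deleting the last letter and, if the $n$-th North step is immediately followed by an East step, replacing that East step by $E^+$ if $\#\{r:\mu_r>0\}$ is even and by $E^-$ if odd. *)

(* Defs.v *)
From HB Require Import structures.
From mathcomp Require Import all_boot all_order all_algebra.
From mathcomp Require Import classical_sets functions.

Set Implicit Arguments.
Unset Strict Implicit.
Unset Printing Implicit Defensive.

Import Order.TTheory GRing.Theory Num.Theory.

Inductive step := North | East | EastPlus | EastMinus.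

Definition step_code (s : step) : option (option bool) :=
  match s with
  | North => None
  | East => Some None
  | EastPlus => Some (Some true)
  | EastMinus => Some (Some false)
  end.

Definition step_decode (c : option (option bool)) : step :=
  match c with
  | None => North
  | Some None => East
  | Some (Some true) => EastPlus
  | Some (Some false) => EastMinus
  end.

Lemma step_codeK : cancel step_code step_decode.
Proof. by case. Qed.

HB.instance Definition _ := Finite.copy step (can_type step_codeK).

Definition is_north (s : step) : bool := s == North.
Definition is_east (s : step) : bool := s != North.

(* Words in the letters N and E only. *)
Definition unsigned (w : seq step) : bool := all (mem [:: North; East]) w.

Definition is_sign (s : step) : bool := s \in [:: EastPlus; EastMinus].

(* Replaces by s those East letters of w whose (0-based) position satisfies P;
   P will always select at most one position. *)
Definition replace_east (P : pred nat) (s : step) (w : seq step) : seq step :=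
  mkseq (fun i => let x := nth North w i in
                  if P i && (x == East) then s else x) (size w).

(* The (0-based) position i immediately follows the n-th North step of w. *)
Definition after_north (n : nat) (w : seq step) : pred nat :=
  fun i => [&& 0 < i, is_north (nth East w i.-1)
             & count is_north (take i w) == n].

Definition lattice_word (n : nat) (w : seq step) : bool :=
  [&& unsigned w, count is_north w == n & count is_east w == n.-1].

Definition ballot_word (m : nat) (w : seq step) : bool :=
  [&& unsigned w, size w == m
    & all (fun k => count is_east (take k w) <= count is_north (take k w))
          (iota 0 (size w).+1)].

Definition signed_lattice_paths (n : nat) : set (seq step) :=
  [set p | exists w s, [/\ lattice_word n w, is_sign s
                         & p = replace_east (pred1 0) s w]]%classic.

Definition signed_ballot_paths (n : nat) : set (seq step) :=
  [set p | exists w s, [/\ ballot_word (2 * n - 1) w, is_sign s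
                         & p = replace_east (after_north n w) s w]]%classic.

Definition sgn_path (p : seq step) : int :=
  (if EastMinus \in p then -1 else 1)%R.

Definition east_counts (p : seq step) : seq nat :=
  [seq count is_east (take k p)
     | k <- iota 0 (size p) & is_north (nth East p k)].

(* pi_i, for 1 <= i <= n. *)
Definition east_before (p : seq step) (i : nat) : nat :=
  nth 0 (east_counts p) i.-1.

Section AreaVector.
Local Open Scope ring_scope.

(* lambda_i, for 1 <= i <= n. *)
Definition lambda_entry (n : nat) (p : seq step) (i : nat) : int :=
  let pi_ k : int := (east_before p k)%:Z in
  if i == 1%N then sgn_path p * pi_ 1%N
  else if (i < n)%N then pi_ i
  else if ~~ odd (\sum_(1 <= k < n.-1) east_before p k)
       then 2 * pi_ n - pi_ n.-1
       else 2 * n%:Z - 1 - 2 * pi_ n + pi_ n.-1.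

(* mu_i, for 1 <= i <= n. *)
Definition area_entry (n : nat) (p : seq step) (i : nat) : int :=
  let lam := lambda_entry n p in
  if (n.-1 %% 4)%N \in [:: 0; 3]%N then lam i - (i.-1)%:Z
  else if i == 1%N then - lam 1%N
  else if (i < n)%N then lam i - (i.-1)%:Z
  else n%:Z - lam n.

Definition area_vector (n : nat) (p : seq step) : seq int :=
  [seq area_entry n p i | i <- iota 1 n].

(* Reads a from left to right, writing N for entries u and E for entries v. *)
Definition read_word (u v : int) (a : seq int) : seq step :=
  pmap (fun x => if x == u then Some North
                 else if x == v then Some East else None) a.

Definition Splus_right (j : nat) (a : seq int) : seq step :=
  read_word j%:Z (j%:Z + 1) a.
Definition Sminus_left (j : nat) (a : seq int) : seq step :=
  read_word (- j%:Z) (- j%:Z - 1) (rev a).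

Definition npos (a : seq int) : nat := count (fun x => 0 < x) a.

End AreaVector.

(* The concatenation runs over j = 2n-1, ..., 1, 0, in this order. *)
Definition sweep_word (n : nat) (a : seq int) : seq step :=
  flatten [seq Sminus_left j a ++ Splus_right j a | j <- rev (iota 0 (2 * n))].

Definition delete_last (w : seq step) : seq step := take (size w).-1 w.

Definition zetaD (n : nat) (p : seq step) : seq step :=
  let mu := area_vector n p in
  let w := delete_last (sweep_word n mu) in
  replace_east (after_north n w)
               (if odd (npos mu) then EastMinus else EastPlus) w.

(* Main.v *)
Require Import Defs.
From mathcomp Require Import all_boot all_order all_algebra zify.
From mathcomp Require Import classical_sets functions.

Set Implicit Arguments.
Unset Strict Implicit.
Unset Printing Implicit Defensive.

Import Order.TTheory GRing.Theory Num.Theory.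

(** Write c = (-a_n, ..., -a_1, a_1, ..., a_n).  The sweep word of a reads, for
    j = 2n-1 down to 0, the entries j (as N) and j+1 (as E) of c from left to
    right; without its last letter it does not change under a_1 -> - a_1 or
    a_n -> 1 - a_n.  Modulo these two moves an area vector may be taken with
    a_1 >= 0 >= a_n, and then c never drops by more than 1.

    Such a c can be recovered from the word.  The part coming from each level j
    ends with N, and the height of the path after the levels >= j is the number
    of entries j of c, so the word can be cut into levels starting from its end.
    The levels fix the relative order of all entries of c differing by at most 1,
    hence fix c, which has no drops by 2 or more.  So paths, up to sign, inject
    into ballot words of length 2n-1, and both sets have binom(2n-1, n) elements.

    The n-th North step is the last 0 of the left half of c, so it is followed
    by an East step iff a_1 <> 0; in that case changing the sign of a_1 changes
    the parity of the number of positive entries of the area vector, which is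
    recorded by the sign of that East step. *)

(** * Levels of an integer sequence, and its recovery from them *)

Section Levels.
Local Open Scope ring_scope.
Implicit Types (c : seq int) (j x y : int).

Definition lev j c : seq step := read_word j (j + 1) c.
#[global] Arguments lev : simpl never.

Definition gentle c : bool := sorted (fun x y => x - 1 <= y) c.

Lemma lev_cons j x c : lev j (x :: c) =
  (if x == j then [:: North] else if x == j + 1 then [:: East] else [::]) ++ lev j c.
Proof. by rewrite /lev /read_word /=; case: ifP => // _; case: ifP. Qed.

Lemma lev_cat j c1 c2 : lev j (c1 ++ c2) = lev j c1 ++ lev j c2.
Proof. by elim: c1 => //= x c IH; rewrite !lev_cons IH catA. Qed.

Lemma unsigned_lev j c : unsigned (lev j c).
Proof.
elim: c => // x c IH; rewrite lev_cons /unsigned all_cat -/(unsigned (lev j c)) IH andbT.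
by case: ifP => // _; case: ifP.
Qed.

Lemma count_north_lev j c : count is_north (lev j c) = count_mem j c.
Proof.
elim: c => // x c IH; rewrite lev_cons count_cat IH /=.
by case: eqP => //=; case: eqP.
Qed.

Lemma count_east_lev j c : count is_east (lev j c) = count_mem (j + 1) c.
Proof.
elim: c => // x c IH; rewrite lev_cons count_cat IH /=.
by case: (x =P j) => [->|_] /=; [case: eqP; lia | case: eqP].
Qed.

Lemma lev_eq0 j c : lev j c = [::] -> j \notin c.
Proof. by move=> h; apply/count_memPn; rewrite -count_north_lev h. Qed.

(** A descent in steps of at most 1 cannot jump over j. *)
Lemma gentle_ivt j x c :
  gentle (x :: c) -> j <= x -> last x c <= j -> j \in x :: c.
Proof.
elim: c x => [|y c IH] x /=; first by rewrite inE => _ *; lia.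
move=> /andP[xy gc] jx lj; rewrite inE; case: (j =P x) => //= ne.
by apply: IH => //; lia.
Qed.

(** A descent from above j meets j + 1 before j, so any first letter is E. *)
Lemma lev_head j x c : gentle (x :: c) -> j < x ->
  lev j (x :: c) = [::] \/ exists w, lev j (x :: c) = East :: w.
Proof.
elim: c x => [|y c IH] x /=.
  move=> _ jx; rewrite lev_cons; case: eqP => [|_]; first by lia.
  by case: eqP => _; [right; exists [::] | left].
move=> /andP[xy gc] jx; rewrite lev_cons; case: eqP => [|_]; first by lia.
by case: eqP => [_|ne]; [right; eexists | apply: IH => //; lia].
Qed.

(** After an entry j + 1 the sequence must still come down to at most j, so it passes through j and
    writes an N. *)
Lemma lev_last j x c : gentle (x :: c) -> last x c <= j ->
  lev j (x :: c) = [::] \/ exists w, lev j (x :: c) = rcons w North.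
Proof.
elim: c x => [|y c IH] x /=.
  move=> _ xj; rewrite lev_cons; case: eqP => [_|_]; first by right; exists [::].
  by case: eqP => [|_]; [lia | left].
move=> gc lj; have /andP[xy gy] := gc.
rewrite lev_cons; case: (IH y gy lj) => [e|[w ->]]; last first.
  by right; eexists; rewrite -rcons_cat.
rewrite e cats0; case: eqP => [_|ne]; first by right; exists [::].
case: eqP => [xj|_]; last by left.
have := @gentle_ivt j x (y :: c) gc; rewrite inE => /(_ _ _)/orP[||/eqP|]//; try lia.
by rewrite (negPf (lev_eq0 e)).
Qed.

(* Prescribing every [lev j c] prescribes c up to commuting entries that differ
   by at least 2; the gentle sequence is the normal form of that class. *)
Lemma gentle_lev_inj c c' :
  gentle c -> gentle c' -> (forall j, lev j c = lev j c') -> c = c'.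
Proof.
(* The smaller head x writes N at once at level x, where the other sequence writes E first or
   nothing at all. *)
have neq x s x' s' : gentle (x' :: s') -> x < x' ->
    lev x (x :: s) = lev x (x' :: s') -> False.
  move=> g lt; rewrite lev_cons eqxx /= => e.
  by case: (lev_head g lt); rewrite -e => //; case.
elim: c c' => [|x s IH] [|x' s'] //.
- by move=> _ _ /(_ x'); rewrite lev_cons eqxx.
- by move=> _ _ /(_ x); rewrite lev_cons eqxx.
move=> g g' e; case: (ltgtP x x') => [lt|lt|ex].
- by case: (neq _ _ _ _ g' lt (e x)).
- by case: (neq _ _ _ _ g lt (esym (e x'))).
subst x'; congr cons; apply: IH; [exact: path_sorted g|exact: path_sorted g'|].
move=> j; have := e j; rewrite !lev_cons.
by do 2?case: ifP => _ //=; case.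
Qed.

Definition levels (k m : nat) c : seq step :=
  flatten [seq lev i%:Z c | i <- rev (iota k m)].
#[global] Arguments levels : simpl never.

Lemma levels0 k c : levels k 0 c = [::].
Proof. by []. Qed.

Lemma levelsS k m c : levels k m.+1 c = levels k.+1 m c ++ lev k%:Z c.
Proof. by rewrite /levels /= rev_cons map_rcons flatten_rcons. Qed.

Lemma unsigned_levels k m c : unsigned (levels k m c).
Proof.
elim: m k => [|m IH] k; first by rewrite levels0.
by rewrite levelsS /unsigned all_cat; apply/andP; split; [exact: IH | exact: unsigned_lev].
Qed.

Lemma count_north_levels k m c :
  count is_north (levels k m c) = count (fun x => k%:Z <= x < (k + m)%:Z) c.
Proof.
elim: m k => [|m IH] k; first by rewrite levels0 /= addn0; elim: c => //= *; lia.
rewrite levelsS count_cat IH count_north_lev.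
by clear IH; elim: c => //= x c; lia.
Qed.

Lemma count_east_levels k m c :
  count is_east (levels k m c) = count (fun x => k%:Z < x <= (k + m)%:Z) c.
Proof.
elim: m k => [|m IH] k; first by rewrite levels0 /= addn0; elim: c => //= *; lia.
rewrite levelsS count_cat IH count_east_lev.
by clear IH; elim: c => //= x c; lia.
Qed.

(** N counts the entries in [k, k + m) and E those in (k, k + m]; as k + m does not occur, only the
    entries k make a difference. *)
Lemma levels_height k m c : (k + m)%:Z \notin c ->
  count is_north (levels k m c) = (count is_east (levels k m c) + count_mem k%:Z c)%N.
Proof.
rewrite count_north_levels count_east_levels.
by elim: c => //= x c IH; rewrite inE negb_or => /andP[ne /IH]; lia.
Qed.

Lemma levels_last k m x c : gentle (x :: c) -> last x c <= k%:Z ->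
  levels k m (x :: c) = [::] \/ exists w, levels k m (x :: c) = rcons w North.
Proof.
move=> g; elim: m k => [|m IH] k lk; first by left.
rewrite levelsS; case: (lev_last g lk) => [->|[w ->]].
  by rewrite cats0; apply: IH; lia.
by right; eexists; rewrite -rcons_cat.
Qed.

(** Were the cuts at different places, the N closing the longer left factor would be an extra N of
    the other right factor. *)
Lemma cat_north_inj (u v u' v' : seq step) :
    (u = [::] \/ exists w, u = rcons w North) ->
    (u' = [::] \/ exists w, u' = rcons w North) ->
    count is_north v = count is_north v' -> u ++ v = u' ++ v' ->
  u = u' /\ v = v'.
Proof.
have lt u1 v1 u2 v2 : (u2 = [::] \/ exists w, u2 = rcons w North) ->
    count is_north v1 = count is_north v2 -> u1 ++ v1 = u2 ++ v2 ->
    (size u1 < size u2)%N -> False.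
  move=> h ev e lt12; case: h => [eu|[w eu]]; first by rewrite eu in lt12.
  move: lt12; rewrite eu size_rcons ltnS => le.
  have eu1 : u1 = take (size u1) w.
    have := congr1 (take (size u1)) e.
    by rewrite take_size_cat // eu cat_rcons takel_cat.
  move: e; rewrite eu cat_rcons -[in RHS](cat_take_drop (size u1) w) -eu1 -catA.
  move=> /eqP; rewrite eqseq_cat // eqxx /= => /eqP ev1.
  by move: ev; rewrite ev1 count_cat /=; lia.
move=> hu hu' ev e; case: (ltngtP (size u) (size u')) => [l|l|es].
- by case: (lt _ _ _ _ hu' ev e l).
- by case: (lt _ _ _ _ hu (esym ev) (esym e) l).
by move/eqP: e; rewrite eqseq_cat // => /andP[/eqP-> /eqP->].
Qed.

(** Levels are split off from the lowest upwards: the final height gives the number of N's in level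
    k, and since the part before it is empty or ends with N, this fixes where level k begins. *)
Lemma levels_inj k m x c x' c' :
    gentle (x :: c) -> last x c <= k%:Z -> (k + m)%:Z \notin x :: c ->
    gentle (x' :: c') -> last x' c' <= k%:Z -> (k + m)%:Z \notin x' :: c' ->
    levels k m (x :: c) = levels k m (x' :: c') ->
  forall j : nat, (k <= j < k + m)%N -> lev j%:Z (x :: c) = lev j%:Z (x' :: c').
Proof.
move=> g + + g'; elim: m k => [|m IH] k lk nk lk' nk' e j; first by lia.
have ek : count_mem k%:Z (x :: c) = count_mem k%:Z (x' :: c').
  by have := levels_height nk; rewrite e (levels_height nk') => /addnI.
have [|||eN el] := cat_north_inj _ _ _ (etrans (etrans (esym (levelsS k m _)) e) (levelsS k m _)).
- by apply: levels_last => //; lia.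
- by apply: levels_last => //; lia.
- by rewrite !count_north_lev.
move=> /andP[kj jm]; case: (eqVneq j k) => [->//|ne].
apply: (IH k.+1) => //; rewrite ?addSnnS //; lia.
Qed.

(** Level k starts at a height equal to the number of entries k + 1, which is the number of its E's,
    so it cannot lead below 0. *)
Lemma levels_prefix k m c i : (k + m)%:Z \notin c ->
  (count is_east (take i (levels k m c)) <= count is_north (take i (levels k m c)))%N.
Proof.
elim: m k => [|m IH] k nk; first by rewrite levels0.
have nk1 : (k.+1 + m)%:Z \notin c by rewrite addSnnS.
rewrite levelsS take_cat; case: ifP => _; first exact: IH.
rewrite !count_cat (levels_height nk1); set w := lev _ _.
have : (count is_east (take (i - size (levels k.+1 m c)) w) <= count is_east w)%N.
  by rewrite -[in leqRHS](cat_take_drop (i - size (levels k.+1 m c)) w) count_cat leq_addr.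
rewrite /w count_east_lev -[(k%:Z + 1)]/((k + 1)%:Z) addn1 => h.
by rewrite -addnA leq_add2l (leq_trans h) // leq_addr.
Qed.

End Levels.

(** * The symmetric sequence c and its sweep word *)

Section Double.
Local Open Scope ring_scope.
Implicit Types (a c s : seq int) (x y : int).

Definition dbl a : seq int := map -%R (rev a) ++ a.

(** Reading a from right to left for -j and -j - 1 is reading its negated reversal from left to
    right for j and j + 1. *)
Lemma sweep_levels n a : sweep_word n a = levels 0 (2 * n) (dbl a).
Proof.
congr flatten; apply: eq_map => j; rewrite /dbl lev_cat; congr cat.
rewrite /Sminus_left; elim: (rev a) => //= x s IH.
rewrite lev_cons -IH /=.
have -> : (- x == j%:Z) = (x == - j%:Z) by lia.
have -> : (- x == j%:Z + 1) = (x == - j%:Z - 1) by lia.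
by case: ifP => // _; case: ifP.
Qed.

Lemma dbl_cons x s : dbl (x :: s) = map -%R (rev s) ++ [:: - x; x] ++ s.
Proof. by rewrite /dbl rev_cons map_rcons cat_rcons. Qed.

Lemma dbl_rcons s y : dbl (rcons s y) = - y :: dbl s ++ [:: y].
Proof. by rewrite /dbl rev_rcons /= -cats1 catA. Qed.

(** The entries -x and x are neighbours in the middle of c, and for x <> 0 only the positive one is
    ever read, so their order is invisible. *)
Lemma sweep_oppl n x s : sweep_word n (- x :: s) = sweep_word n (x :: s).
Proof.
rewrite !sweep_levels; congr flatten; apply: eq_map => j.
rewrite !dbl_cons !lev_cat !lev_cons opprK; congr (_ ++ (_ ++ _)).
by do ?[case: eqP => /= ?] => //; lia.
Qed.

Lemma levels_top k m c : levels k m.+1 c = lev (k + m)%:Z c ++ levels k m c.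
Proof. by rewrite /levels -addn1 iotaD rev_cat map_cat. Qed.

(* The bottom entry of one level and the top entry of the next one are adjacent
   in the sweep word, so exchanging y and 1 - y only alters the two ends. *)
Lemma levels_flip y c m : exists w,
  levels 0 m.+1 (- y :: c ++ [:: y]) = lev m%:Z [:: - y] ++ w ++ lev 0 [:: y] /\
  levels 0 m.+1 (- (1 - y) :: c ++ [:: 1 - y]) =
    lev m%:Z [:: - (1 - y)] ++ w ++ lev 0 [:: 1 - y].
Proof.
have levE j z : lev j (- z :: c ++ [:: z]) = lev j [:: - z] ++ lev j c ++ lev j [:: z].
  by rewrite -cat1s !lev_cat.
elim: m => [|m [w [e1 e2]]].
  by exists (lev 0 c); rewrite !levelsS !levels0 /= !levE.
exists (lev m.+1%:Z c ++ (lev m.+1%:Z [:: y] ++ lev m%:Z [:: - y]) ++ w).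
split; rewrite levels_top levE ?e1 ?e2 add0n -!catA //.
congr (_ ++ (_ ++ _)); rewrite !catA; congr ((_ ++ _) ++ _).
(* The letter of y at level m + 1 is that of -(1 - y) at level m, and the letter of 1 - y at level m
   + 1 is that of -y at level m. *)
rewrite !lev_cons /=.
by do ?[case: eqP => /= ?] => //; lia.
Qed.

Lemma delete_last_rcons (w : seq step) l : delete_last (rcons w l) = w.
Proof. by rewrite /delete_last size_rcons /= -cats1 take_size_cat. Qed.

(** The bound empties the upper end. The lower end is a single letter if y is 0 or 1, and then it is
    the one deleted; otherwise it is empty for both y and 1 - y. *)
Lemma sweep_flip n s y : `|y| < 2 * n%:Z - 1 ->
  delete_last (sweep_word n (rcons s (1 - y))) = delete_last (sweep_word n (rcons s y)).
Proof.
move=> hy; rewrite !sweep_levels !dbl_rcons.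
case: n hy => [|n] hy; first by lia.
have -> : (2 * n.+1 = (2 * n).+2)%N by lia.
have [w [-> ->]] := levels_flip y (dbl s) (2 * n).+1.
rewrite !lev_cons /=.
by do ?[case: eqP => ? /=]; rewrite ?cats1 ?delete_last_rcons //; lia.
Qed.

Lemma gentle_cat s1 x s2 : gentle s1 -> gentle (x :: s2) -> last x s1 - 1 <= x ->
  gentle (s1 ++ x :: s2).
Proof. by case: s1 => //= y s1 g g2 h; rewrite /gentle /= cat_path g /= h. Qed.

Lemma gentle_opp_rev a : gentle a -> gentle (map -%R (rev a)).
Proof.
move=> g; rewrite /gentle sorted_map rev_sorted; apply: sub_sorted g => x y /=.
by lia.
Qed.

Definition normal a := [&& gentle a, 0 <= head 0 a & last 0 a <= 0].

(** At the seam of the two halves c goes from -x to x, which is no drop as x >= 0. *)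
Lemma dbl_normal x s : normal (x :: s) ->
  exists y c, [/\ dbl (x :: s) = y :: c, gentle (y :: c) & last y c <= 0].
Proof.
move=> /and3P[g /= x0 l0].
have gd : gentle (dbl (x :: s)).
  apply: gentle_cat => //; first exact: gentle_opp_rev.
  by rewrite rev_cons map_rcons last_rcons; lia.
have ld : last 0 (dbl (x :: s)) = last x s by rewrite last_cat.
have : (0 < size (dbl (x :: s)))%N by rewrite size_cat addnS.
case: (dbl _) gd ld => //= y c gd ld _.
by exists y, c; rewrite ld.
Qed.

Definition bounded n a := all (fun x => `|x| < 2 * n%:Z) a.

Lemma count_dbl (P : pred int) a : count P (dbl a) = (count (fun x => P (- x)) a + count P a)%N.
Proof. by rewrite count_cat count_map count_rev. Qed.

Lemma size_unsigned w : size w = (count is_north w + count is_east w)%N.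
Proof. by rewrite -(count_predC is_north). Qed.

(** Each pair -x, x writes two letters: N at level |x| and E at level |x| - 1 if x <> 0, and N twice
    at level 0 if x = 0. *)
Lemma size_sweep n a : bounded n a -> size (sweep_word n a) = (2 * size a)%N.
Proof.
rewrite sweep_levels size_unsigned count_north_levels count_east_levels !count_dbl add0n.
elim: a => //= x a IH /andP[hx /IH]; lia.
Qed.

Lemma bounded_dbl n a : bounded n a -> (2 * n)%:Z \notin dbl a.
Proof.
move=> b; apply/count_memPn; rewrite count_dbl.
by elim: a b => //= x a IH /andP[hx /IH]; lia.
Qed.

Lemma sweep_rcons n x s : (0 < n)%N -> bounded n (x :: s) -> normal (x :: s) ->
  exists w, sweep_word n (x :: s) = rcons w North.
Proof.
move=> n0 b nm; have := size_sweep b; rewrite sweep_levels.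
have [y [c [-> g l]]] := dbl_normal nm.
by case: (@levels_last 0 (2 * n) y c g l) => [->|].
Qed.

Lemma ballot_core n x s : (0 < n)%N -> size (x :: s) = n -> bounded n (x :: s) ->
  normal (x :: s) -> ballot_word (2 * n - 1) (delete_last (sweep_word n (x :: s))).
Proof.
move=> n0 sz b nm; have ss := size_sweep b.
have [w ew] := sweep_rcons n0 b nm.
have bd := bounded_dbl b; have us := unsigned_levels 0 (2 * n) (dbl (x :: s)).
move: ss us (fun i => @levels_prefix 0 (2 * n) _ i bd).
rewrite -sweep_levels ew delete_last_rcons size_rcons sz => ss us pr.
rewrite /ballot_word; apply/and3P; split.
- by move: us; rewrite /unsigned all_rcons => /andP[].
- by apply/eqP; lia.
apply/allP => i; rewrite mem_iota add0n => /andP[_ hi].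
by have := pr i; rewrite -cats1 takel_cat.
Qed.

Lemma opp_rev_dbl a : map -%R (rev (dbl a)) = dbl a.
Proof.
rewrite /dbl rev_cat map_cat -map_rev revK -map_comp; congr cat.
by rewrite -[RHS]map_id; apply: eq_map => x /=; rewrite opprK.
Qed.

Definition swap (s : step) := if s is North then East else North.

(** Negation takes j and j + 1 to the upper and the lower entry of level -j - 1. As c is its own
    negated reversal, this yields the negative levels, which the sweep does not read. *)
Lemma lev_opp_rev j c : lev (- j - 1) (map -%R (rev c)) = map swap (rev (lev j c)).
Proof.
elim: c => // x c IH; rewrite rev_cons map_rcons -cats1 lev_cat IH !lev_cons.
rewrite rev_cat map_cat; congr cat; rewrite cats0.
by do ?[case: eqP => /= ?] => //; lia.
Qed.

Lemma lev_out n (j : int) a : bounded n a -> 2 * n%:Z <= j -> lev j (dbl a) = [::].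
Proof.
move=> b hj; apply/eqP; rewrite -size_eq0 size_unsigned count_north_lev count_east_lev.
rewrite !count_dbl; apply/eqP.
by elim: a b => //= x a IH /andP[hx /IH]; lia.
Qed.

Lemma core_inj n x s x' s' : (0 < n)%N -> size (x :: s) = n -> size (x' :: s') = n ->
    bounded n (x :: s) -> bounded n (x' :: s') -> normal (x :: s) -> normal (x' :: s') ->
    delete_last (sweep_word n (x :: s)) = delete_last (sweep_word n (x' :: s')) ->
  x :: s = x' :: s'.
Proof.
move=> n0 sz sz' b b' nm nm'.
have [w ew] := sweep_rcons n0 b nm; have [w' ew'] := sweep_rcons n0 b' nm'.
(* Both deleted letters are N, so the full sweep words agree as well. *)
rewrite ew ew' !delete_last_rcons => eww.
have {w w' eww ew ew'} : sweep_word n (x :: s) = sweep_word n (x' :: s') by rewrite ew ew' eww.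
rewrite !sweep_levels => e.
have pos (j : nat) : lev j%:Z (dbl (x :: s)) = lev j%:Z (dbl (x' :: s')).
  case: (ltnP j (2 * n)) => hj; last by rewrite !(lev_out (n := n)) //; lia.
  move: e (bounded_dbl b) (bounded_dbl b').
  have [y [c [-> g l]]] := dbl_normal nm; have [y' [c' [-> g' l']]] := dbl_normal nm'.
  by move=> e nb nb'; apply: (levels_inj (k := 0) (m := 2 * n)).
have ed : dbl (x :: s) = dbl (x' :: s').
  apply: gentle_lev_inj.
  - by have [y [c [-> g l]]] := dbl_normal nm.
  - by have [y [c [-> g l]]] := dbl_normal nm'.
  case=> [j|j]; first exact: pos.
  have -> : Negz j = - j%:Z - 1 by lia.
  by rewrite -(opp_rev_dbl (x :: s)) -(opp_rev_dbl (x' :: s')) !lev_opp_rev pos.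
move/eqP: ed; rewrite /dbl eqseq_cat ?size_map ?size_rev ?sz ?sz' //.
by move=> /andP[_ /eqP].
Qed.

End Double.

(** * Placing the sign on an East step and reading it off *)

Section Marking.
Implicit Types (P : pred nat) (s : step) (w : seq step).

Definition marked P w : bool :=
  has (fun i => P i && (nth North w i == East)) (iota 0 (size w)).

Lemma markedP P w :
  reflect (exists i, [/\ i < size w, P i & nth North w i = East]) (marked P w).
Proof.
apply: (iffP hasP) => [[i]|[i [hi Pi e]]].
  by rewrite mem_iota add0n => /andP[_ hi] /andP[Pi /eqP e]; exists i.
by exists i; rewrite ?mem_iota ?Pi ?e.
Qed.

Definition unsign s : step := if is_sign s then East else s.

Lemma unsigned_nth w i : unsigned w -> nth North w i \in [:: North; East].
Proof.
move=> /allP u; case: (ltnP i (size w)) => h; last by rewrite nth_default.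
exact/u/mem_nth.
Qed.

Lemma map_unsign_replace P s w : unsigned w -> is_sign s ->
  map unsign (replace_east P s w) = w.
Proof.
move=> u hs; apply: (@eq_from_nth _ North); rewrite size_map size_mkseq // => i hi.
rewrite (nth_map North) ?size_mkseq // nth_mkseq //=.
have := unsigned_nth i u; rewrite !inE.
by case: ifP => [/andP[_ /eqP->] _|_ /orP[]/eqP->] //; rewrite /unsign hs.
Qed.

Lemma replace_unmarked P s w : ~~ marked P w -> replace_east P s w = w.
Proof.
move=> nm; apply: (@eq_from_nth _ North); rewrite size_mkseq // => i hi.
rewrite nth_mkseq //=; case: ifP => // /andP[Pi /eqP e].
by case/markedP: nm; exists i.
Qed.

Lemma sign_replace P s s' w : unsigned w -> is_sign s -> is_sign s' ->
  (s' \in replace_east P s w) = marked P w && (s' == s).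
Proof.
move=> u hs hs'; apply/idP/idP.
  move=> /mapP[i]; rewrite mem_iota add0n => /andP[_ hi] /=.
  case: ifP => [/andP[Pi /eqP e] ->|_ e].
    by rewrite eqxx andbT; apply/markedP; exists i.
  by have := unsigned_nth i u; rewrite -e; case: s' hs' {e}.
case/andP=> /markedP[i [hi Pi e]] /eqP->.
by apply/mapP; exists i; rewrite ?mem_iota //= Pi e.
Qed.

Lemma replace_inj P s s' w : unsigned w -> is_sign s -> is_sign s' -> marked P w ->
  replace_east P s w = replace_east P s' w -> s = s'.
Proof.
move=> u hs hs' m e; have := sign_replace P u hs hs; rewrite m eqxx e.
by rewrite sign_replace // m => /eqP.
Qed.

(** The n-th N may lie well inside u, but then all later letters of u are E. *)
Lemma after_north_marked n (u v : seq step) : 0 < n -> unsigned u -> count is_north u = n ->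
  marked (after_north n (u ++ East :: v)) (u ++ East :: v).
Proof.
move=> n0 hu cu; set w := u ++ _.
have ex : exists i, count is_north (take i w) == n.
  by exists (size u); rewrite take_size_cat ?cu.
(* The least such i is the position right after the n-th N. *)
case: (ex_minnP ex) => i /eqP ci mi.
have iu : i <= size u by apply: mi; rewrite take_size_cat ?cu.
have sw : size w = (size u + (size v).+1)%N by rewrite size_cat.
have i0 : 0 < i by case: i ci {mi iu} => //; rewrite take0 /=; lia.
apply/markedP; exists i; split; first by lia.
  rewrite /after_north i0 ci eqxx andbT /=.
  have hi : i.-1 < size w by lia.
  have := take_nth East hi; rewrite prednK // => et.
  case E: (is_north _) => //; have := mi i.-1; suff -> : count is_north (take i.-1 w) == n by lia.
  by move: ci; rewrite et -cats1 count_cat /= E !addn0 => ->.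
rewrite nth_cat; case: ltngtP iu => // [lt _|-> _]; last by rewrite subnn.
have := count_cat is_north (take i u) (drop i u); rewrite cat_take_drop cu.
have := ci; rewrite /w takel_cat; last by lia.
move=> ->.
rewrite (drop_nth North) //=.
have := unsigned_nth i hu; rewrite !inE => /orP[]/eqP-> //.
by rewrite /is_north eqxx; lia.
Qed.

(** The displayed N is the n-th one; the default value of [head] covers a word that ends there. *)
Lemma after_north_unmarked n (u v : seq step) : count is_north u = n.-1 -> 0 < n ->
  head North v = North -> ~~ marked (after_north n (u ++ North :: v)) (u ++ North :: v).
Proof.
move=> cu n0 hv; apply/markedP => -[i [hi /and3P[i0 _ /eqP ci]]].
move: ci; rewrite take_cat nth_cat; case: ltnP => iu.
  have : count is_north (take i u) <= count is_north u.
    by rewrite -[in leqRHS](cat_take_drop i u) count_cat leq_addr.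
  by lia.
case: (i - size u) => [|[|k]] //=.
  by case: v hv {hi} => //= s v ->.
by case: v hv {hi} => //= s v ->; rewrite count_cat /= => ?; lia.
Qed.

End Marking.

(** * Counting ballot words *)

Section Counting.

(** Words of length m that start at height h and never go below height 0. *)
Fixpoint bwords (h m : nat) : seq (seq step) :=
  if m is m'.+1 then
    map (cons North) (bwords h.+1 m') ++
    (if h is h'.+1 then map (cons East) (bwords h' m') else [::])
  else [:: [::]].

Lemma mem_bwords h w : unsigned w ->
  (forall k, count is_east (take k w) <= h + count is_north (take k w)) ->
  w \in bwords h (size w).
Proof.
elim: w h => // x w IH h /andP[hx u] pr.
rewrite [bwords _ _]/= mem_cat.
move: hx pr; rewrite !inE => /orP[]/eqP-> pr.
  rewrite map_f //; apply: IH => // k; have := pr k.+1; rewrite /=; lia.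
case: h pr => [|h] pr; first by have := pr 1; rewrite /= take0.
rewrite orbC map_f //; apply: IH => // k; have := pr k.+1; rewrite /=; lia.
Qed.

(** In passing from m + 1 to m, Pascal's rule splits summand i > 0 into the summands i + 1 and i -
    1, and summand 0 into the summands 1 and 0. Regrouped, these are the sums for h + 1 and h - 1,
    the heights after a first N or E. *)
Lemma size_bwords h m : size (bwords h m) = \sum_(i < h.+1) 'C(m, uphalf (m + i)).
Proof.
elim: m h => [|m IH] h.
  by rewrite big_ord_recl big1 //= => i _; rewrite add0n; case: i => -[|i] hi //=; rewrite bin0n.
have step i : 'C(m.+1, uphalf (m.+1 + i.+1)) = 'C(m, uphalf (m + i.+2)) + 'C(m, uphalf (m + i)).
  by rewrite !addSn !addnS /= binS.
have step0 : 'C(m.+1, uphalf m.+1) = 'C(m, uphalf (m + 1)) + 'C(m, uphalf (m + 0)).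
  rewrite addn0 addn1 /= binS; congr addn.
  (* For odd m the two middle binomial coefficients agree by symmetry. *)
  have := odd_double_half m; set q := m./2; case: (odd m) => <-.
    by rewrite add1n /= doubleK -[RHS]bin_sub; [congr 'C(_, _) |]; lia.
  by rewrite add0n uphalf_double.
have recl2 : \sum_(i < h.+2) 'C(m, uphalf (m + i)) =
    'C(m, uphalf (m + 0)) + 'C(m, uphalf (m + 1)) + \sum_(i < h) 'C(m, uphalf (m + i.+2)).
  by rewrite 2!big_ord_recl addnA.
rewrite [bwords _ _]/= size_cat size_map IH recl2 big_ord_recl.
rewrite (_ : uphalf (m.+1 + @ord0 h) = uphalf m.+1); last by rewrite addn0.
rewrite step0.
under [in RHS]eq_bigr do rewrite lift0 step.
rewrite big_split /=.
have -> : size (if h is h'.+1 then map (cons East) (bwords h' m) else [::]) =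
    \sum_(i < h) 'C(m, uphalf (m + i)).
  by case: h {recl2} => [|h]; rewrite ?big_ord0 ?size_map.
by rewrite addnA [X in X + _ + _]addnC.
Qed.

End Counting.

(** * The sweep on normalised area vectors *)

Section Core.
Local Open Scope ring_scope.
Implicit Types (p w : seq step) (pi : seq nat).

Definition core n (a : seq int) : seq step := delete_last (sweep_word n a).

Lemma marked_core n (x : int) s : (0 < n)%N -> size (x :: s) = n ->
    bounded n (x :: s) -> normal (x :: s) ->
  marked (after_north n (core n (x :: s))) (core n (x :: s)) = (0 < x).
Proof.
move=> n0 sz b nm; have /and3P[g /= x0 l0] := nm.
rewrite /core sweep_levels.
have [m em] : exists m, (2 * n = m.+1)%N by exists (2 * n).-1; lia.
rewrite em levelsS {3}/dbl lev_cat catA.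
set u := levels _ _ _ ++ _.
(* The right half comes down from x >= 0 to at most 0, so it contains a 0, and its level 0 ends with
   the N that is deleted. *)
have [z ez] : exists z, lev 0 (x :: s) = rcons z North.
  case: (lev_last g l0) => // e.
  by have := gentle_ivt g x0 l0; rewrite (negPf (lev_eq0 e)).
(* Each pair -y, y writes exactly one N in u: at level |y| if y <> 0, and in the left half of level
   0 if y = 0. *)
have cu : count is_north u = n.
  rewrite /u count_cat count_north_levels count_north_lev count_dbl count_map count_rev add1n -em -[RHS]sz.
  by clear -b; elim: (x :: s) b => //= y t IH /andP[hy /IH]; lia.
have hu : unsigned u by rewrite /unsigned all_cat; apply/andP; split; [exact: unsigned_levels|exact: unsigned_lev].
(* For x > 0 the right half starts its level 0 with E. For x = 0 the two middle zeros write adjacent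
   N's, the first of which is the n-th; the second may be the deleted letter. *)
case: (ltgtP 0 x) x0 => // [xp _|ex _].
  case: (lev_head g xp) => [e|[v ev]]; first by rewrite e in ez; case: z ez.
  rewrite ez; case: z ez => [|t z] ez; first by rewrite ez in ev.
  rewrite -rcons_cat delete_last_rcons.
  have -> : t = East by move: ez; rewrite ev rcons_cons => -[].
  exact: after_north_marked.
rewrite ez -rcons_cat delete_last_rcons.
have [v ev] : exists v, u = rcons v North.
  rewrite /u rev_cons map_rcons -cats1 lev_cat -ex lev_cons /= catA cats1.
  by eexists.
have hz : head North z = North.
  by move: ez; rewrite -ex lev_cons /=; case: z => //= t z [].
rewrite ev cat_rcons; apply/negbTE/after_north_unmarked => //.
by move: cu; rewrite ev -cats1 count_cat /=; lia.
Qed.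

(** The sequences pi_1 <= ... <= pi_n that come from lattice words with n North and n - 1 East
    steps. *)
Definition valid n pi := [&& sorted leq pi, size pi == n & all (fun k => k < n)%N pi].

(** With q = 2 pi_n - pi_(n-1), the last area entry is always q - (n - 1) or n - q. These add up to
    1, and the one that is at most 0 is chosen. *)
Definition top_entry n pi : int :=
  let q := 2 * (nth 0%N pi n.-1)%:Z - (nth 0%N pi n.-2)%:Z in
  if q < n%:Z then q - n.-1%:Z else n%:Z - q.

Definition mid_entries n pi : seq int :=
  [seq (nth 0%N pi i)%:Z - i%:Z | i <- iota 1 n.-2].

(* The area vector modulo the changes a_1 -> - a_1 and a_n -> 1 - a_n, neither
   of which affects the word. *)
Definition fold_area n pi : seq int :=
  (nth 0%N pi 0)%:Z :: rcons (mid_entries n pi) (top_entry n pi).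

Lemma size_fold_area n pi : (1 < n)%N -> size (fold_area n pi) = n.
Proof. by move=> n1; rewrite /= size_rcons size_map size_iota; lia. Qed.

Lemma nth_fold_area n pi i : (1 < n)%N -> (i < n)%N -> nth 0 (fold_area n pi) i =
  if i == n.-1 then top_entry n pi else (nth 0%N pi i)%:Z - i%:Z.
Proof.
move=> n1 hi; case: i hi => [|i] hi /=; first by case: eqP; lia.
rewrite nth_rcons size_map size_iota.
case: ltnP => h; last by rewrite !ifT //; lia.
rewrite ifF; last by lia.
by rewrite (nth_map 0%N) ?size_iota // nth_iota.
Qed.

Lemma valid_nth n pi : valid n pi ->
  (forall i, (i.+1 < n)%N -> (nth 0 pi i <= nth 0 pi i.+1)%N) /\
  (forall i, (i < n)%N -> (nth 0 pi i < n)%N).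
Proof.
case/and3P=> /sortedP so /eqP sz /allP al; split=> i hi; first by apply: so; rewrite sz.
by apply/al/mem_nth; rewrite sz.
Qed.

(** The lower bound is the preceding area entry minus 1, as [gentle] demands. *)
Lemma top_entry_bounds n pi : (1 < n)%N -> valid n pi ->
  (nth 0%N pi n.-2)%:Z - n.-1%:Z <= top_entry n pi <= 0.
Proof.
move=> n1 /valid_nth[mo bd]; have := mo n.-2; have := bd n.-1.
rewrite (_ : n.-2.+1 = n.-1); last by lia.
by rewrite /top_entry; case: ifP; lia.
Qed.

Lemma normal_fold n pi : (1 < n)%N -> valid n pi -> normal (fold_area n pi).
Proof.
move=> n1 v; have [mo bd] := valid_nth v; have tb := top_entry_bounds n1 v.
apply/and3P; split; [|by []|by rewrite /= last_rcons; lia].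
apply/(sortedP 0) => i; rewrite size_fold_area // => hi.
rewrite !nth_fold_area //; try lia.
have := mo i hi; rewrite /=; case: eqP => [|_]; first by lia.
rewrite /=; case: eqP => [e|_]; last by lia.
have ei : i = n.-2 by lia.
by rewrite ei; lia.
Qed.

Lemma bounded_fold n pi : (1 < n)%N -> valid n pi -> bounded n (fold_area n pi).
Proof.
move=> n1 v; have [mo bd] := valid_nth v; have tb := top_entry_bounds n1 v.
apply/(all_nthP 0) => i; rewrite size_fold_area // => hi.
by rewrite nth_fold_area //; have := bd i hi; case: eqP; lia.
Qed.

(** Folding the last entry confuses only q and 2n - 1 - q, which have different parities, while q
    has the parity of the known pi_(n-1). *)
Lemma fold_area_inj n pi pi' : (1 < n)%N -> valid n pi -> valid n pi' ->
  fold_area n pi = fold_area n pi' -> pi = pi'.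
Proof.
move=> n1 v v' e.
have /and3P[_ /eqP sz _] := v; have /and3P[_ /eqP sz' _] := v'.
have low i : (i < n.-1)%N -> nth 0%N pi i = nth 0%N pi' i.
  move=> hi; have := congr1 (nth 0 ^~ i) e.
  rewrite /= !nth_fold_area //; try lia.
  by case: eqP; lia.
have tp : top_entry n pi = top_entry n pi'.
  have := congr1 (nth 0 ^~ n.-1) e; rewrite /= !nth_fold_area //; try lia.
  by rewrite eqxx.
apply: (@eq_from_nth _ 0%N); rewrite ?sz ?sz' // => i hi.
case: (ltnP i n.-1) => h; first exact: low.
have -> : i = n.-1 by lia.
move: tp; rewrite /top_entry (low n.-2); last by lia.
by do 2!case: ifP; lia.
Qed.

Lemma core_fold_inj n pi pi' : (1 < n)%N -> valid n pi -> valid n pi' ->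
  core n (fold_area n pi) = core n (fold_area n pi') -> pi = pi'.
Proof.
move=> n1 v v' e; apply: (fold_area_inj n1 v v').
apply: (core_inj (n := n)) => //; try exact: size_fold_area; try exact: bounded_fold;
  try exact: normal_fold.
by lia.
Qed.

(** The injection [core_fold_inj] maps into a list that is no longer than its domain, so it reaches
    every word of it. *)
Lemma core_fold_surj n w : (1 < n)%N -> ballot_word (2 * n - 1) w ->
  exists2 pi, valid n pi & core n (fold_area n pi) = w.
Proof.
case: n => // n n1 bw.
pose A := [set t : n.+1.-tuple 'I_n.+1 | sorted leq (map val t)].
pose L := [seq map val t | t : n.+1.-tuple 'I_n.+1 in A].
have vL pi : pi \in L -> valid n.+1 pi.
  case/mapP => t; rewrite mem_enum inE => st ->; apply/and3P; split => //.
    by rewrite size_map size_tuple.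
  by apply/allP => k /mapP[i _ ->]; apply: ltn_ord.
have uL : uniq L.
  rewrite map_inj_in_uniq ?enum_uniq // => t t' _ _ e.
  by apply/val_inj/(inj_map val_inj).
have bal w' : ballot_word (2 * n.+1 - 1) w' -> w' \in bwords 0 (2 * n.+1 - 1).
  case/and3P => u /eqP sz /allP pr; rewrite -sz; apply: mem_bwords => // k.
  case: (leqP k (size w')) => hk; first by apply: pr; rewrite mem_iota; lia.
  rewrite take_oversize; last by lia.
  by have := pr (size w'); rewrite take_size mem_iota; apply; lia.
pose f pi := core n.+1 (fold_area n.+1 pi).
have uf : uniq (map f L).
  by rewrite map_inj_in_uniq // => pi pi' /vL v /vL v'; apply: core_fold_inj.
have sub : {subset map f L <= bwords 0 (2 * n.+1 - 1)}.
  move=> w' /mapP[pi /vL v ->]; apply/bal/ballot_core => //.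
  - exact: size_fold_area.
  - exact: bounded_fold.
  - exact: normal_fold.
have szle : (size (bwords 0 (2 * n.+1 - 1)) <= size (map f L))%N.
  (* Both sizes are binom(2n + 1, n + 1), where n now stands for one less than the original n. *)
  rewrite size_bwords big_ord_recl big_ord0 !addn0 !size_map -cardE card_sorted_tuples.
  have -> : (2 * n.+1 - 1 = n.*2.+1)%N by lia.
  by rewrite /= doubleK; apply/eq_leq; congr 'C(_, _); lia.
have [_ eqm] := uniq_min_size uf sub szle.
by move: (bal w bw); rewrite -eqm => /mapP[pi /vL v ->]; exists pi.
Qed.

End Core.

(** * Lattice words and their East counts *)

Section Lattice.
Implicit Types (w p : seq step) (pi : seq nat).

Lemma is_eastE (s : step) : is_east s = ~~ is_north s.
Proof. by []. Qed.

Lemma east_counts_cons x w : east_counts (x :: w) =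
  if is_north x then 0 :: east_counts w else map succn (east_counts w).
Proof.
rewrite /east_counts /= -[1]addn0 iotaDl filter_map.
rewrite (@eq_filter _ _ (fun k => is_north (nth East w k))) //.
set r := filter _ _; case: ifP => /= nx; rewrite -!map_comp.
  by congr cons; apply: eq_map => k; rewrite /= is_eastE nx.
by apply: eq_map => k; rewrite /= is_eastE nx.
Qed.

Lemma size_east_counts w : size (east_counts w) = count is_north w.
Proof.
elim: w => // x w IH; rewrite east_counts_cons /= -IH.
by case: ifP => //= _; rewrite size_map.
Qed.

Lemma sorted_east_counts w : sorted leq (east_counts w).
Proof.
elim: w => // x w IH; rewrite east_counts_cons; case: ifP => _ /=.
  by case: (east_counts w) IH.
by rewrite sorted_map.
Qed.

Lemma all_east_counts w : all (fun k => k <= count is_east w) (east_counts w).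
Proof.
elim: w => // x w IH; rewrite east_counts_cons /=.
case: ifP => nx /=.
  by rewrite is_eastE nx.
by rewrite is_eastE nx all_map.
Qed.

Lemma east_counts_inj w w' : unsigned w -> unsigned w' ->
  count is_east w = count is_east w' -> east_counts w = east_counts w' -> w = w'.
Proof.
have nz c u : 0 :: c <> map succn u by case: u.
elim: w w' => [|x w IH] [|x' w'] //.
- move=> _ /andP[hx _]; move: hx; rewrite !inE => /orP[]/eqP-> //=.
- move=> /andP[hx _] _; move: hx; rewrite !inE => /orP[]/eqP-> //=.
move=> /andP[hx u] /andP[hx' u']; move: hx hx'; rewrite !inE !east_counts_cons.
move=> /orP[]/eqP-> /orP[]/eqP-> /=; rewrite ?add0n.
- by move=> ce [/(IH _ u u' ce)->].
- by move=> _ /nz.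
- by move=> _ /esym/nz.
by move=> /addnI ce /(inj_map succn_inj)/(IH _ u u' ce)->.
Qed.

(** The word is built letter by letter: a first count 0 is used up by an N; otherwise an E lowers
    all counts and m by 1. *)
Lemma east_counts_surj m pi : sorted leq pi -> all (fun k => k <= m) pi ->
  exists w, [/\ unsigned w, count is_north w = size pi, count is_east w = m
    & east_counts w = pi].
Proof.
elim: m pi => [|m IHm] pi.
  move=> _ al; exists (nseq (size pi) North).
  elim: pi al => //= k pi IH /andP[]; rewrite leqn0 => /eqP-> /IH[u cn ce ec].
  by split; rewrite // ?cn // east_counts_cons ec.
elim: pi => [|k pi IHpi].
  by move=> _ _; have [//|//|w [u cn ce ec]] := IHm [::]; exists (East :: w);
     split; rewrite ?east_counts_cons /= ?ec ?cn ?ce.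
case: k => [|k].
  move=> /= so al; have [|//|w [u cn ce ec]] := IHpi; first exact: path_sorted so.
  by exists (North :: w); split; rewrite ?east_counts_cons /= ?ec ?cn ?ce.
move=> so al.
have ps : map succn (map predn (k.+1 :: pi)) = k.+1 :: pi.
  rewrite -map_comp -[RHS]map_id; apply/eq_in_map => -[|j] //=.
  rewrite inE /= => h; have /allP/(_ _ h) := order_path_min leq_trans so.
  by [].
have [||w [u cn ce ec]] := IHm (map predn (k.+1 :: pi)).
- by move: so; rewrite -{1}ps sorted_map.
- by move: al; rewrite -{1}ps all_map.
by exists (East :: w); split; rewrite ?east_counts_cons ?ec ?ps //= ?cn ?ce ?size_map.
Qed.

(** The counts depend only on which letters are N, and a sign is put only on an East step. *)
Lemma east_counts_replace P s w : is_sign s ->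
  east_counts (replace_east P s w) = east_counts w.
Proof.
move=> hs; set p := replace_east P s w.
have en : map is_north p = map is_north w.
  rewrite /p /replace_east -[in RHS](mkseq_nth North w) -!map_comp.
  apply: eq_map => i /=; case: ifP => // /andP[_ /eqP->].
  by case: s hs {p}.
have E k : count is_east (take k p) = count is_east (take k w).
  have h u : count is_east u = count negb (map is_north u) by rewrite count_map.
  by rewrite !h !map_take en.
have sz : size p = size w by rewrite -(size_map is_north) en size_map.
rewrite /east_counts sz.
have -> : [seq k <- iota 0 (size w) | is_north (nth East p k)] =
          [seq k <- iota 0 (size w) | is_north (nth East w k)].
  apply: eq_in_filter => k; rewrite mem_iota add0n => /andP[_ hk].
  by rewrite -!(nth_map East true) ?en ?sz.
by apply: eq_map.
Qed.

End Lattice.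

(** * From area vectors to their normal forms *)

Section Area.
Local Open Scope ring_scope.
Implicit Types (p : seq step).

Lemma area_entry1 n p : area_entry n p 1 =
  (if (n.-1 %% 4)%N \in [:: 0; 3]%N then 1 else -1) *
  (sgn_path p * (nth 0%N (east_counts p) 0)%:Z).
Proof.
by rewrite /area_entry /lambda_entry /= /east_before; case: ifP => _; rewrite ?subr0 ?mul1r ?mulN1r.
Qed.

Lemma area_entry_mid n p i : (1 < i < n)%N ->
  area_entry n p i = (nth 0%N (east_counts p) i.-1)%:Z - i.-1%:Z.
Proof.
move=> /andP[i1 i2]; have ne1 : (i == 1%N) = false by lia.
by rewrite /area_entry /lambda_entry i2 /east_before ne1 if_same.
Qed.

Lemma area_entry_last n p : (2 < n)%N ->
  area_entry n p n = top_entry n (east_counts p) \/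
  area_entry n p n = 1 - top_entry n (east_counts p).
Proof.
move=> n2; have ne1 : (n == 1%N) = false by lia.
rewrite /area_entry /lambda_entry ltnn /east_before ne1.
rewrite /top_entry; set a := nth _ _ _; set b := nth _ _ _.
by case: ifP => _; case: ifP => _; case: ifP => _; lia.
Qed.

Lemma area_entry_last_counts n p p' : n != 1%N -> east_counts p = east_counts p' ->
  area_entry n p n = area_entry n p' n.
Proof.
by move=> n1 e; rewrite /area_entry /lambda_entry !(negPf n1) /east_before e.
Qed.

Lemma area_vectorE n p : (2 < n)%N -> area_vector n p =
  area_entry n p 1 :: rcons (mid_entries n (east_counts p)) (area_entry n p n).
Proof.
case: n => [|[|n]] // n2; rewrite /area_vector.
have -> : iota 1 n.+2 = 1%N :: rcons (iota 2 n) n.+2.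
  transitivity (1%N :: iota 2 (n + 1)); first by rewrite addn1.
  by rewrite iotaD cats1 add2n.
rewrite /= map_rcons; congr (_ :: rcons _ _).
rewrite /mid_entries /= -[2%N]/(1 + 1)%N iotaDl -map_comp.
apply/eq_in_map => i; rewrite mem_iota => hi /=.
by rewrite area_entry_mid //; lia.
Qed.

Lemma sgn_path_cases p : sgn_path p = 1 \/ sgn_path p = -1.
Proof. by rewrite /sgn_path; case: ifP; [right|left]. Qed.

Lemma core_area n p : (2 < n)%N -> valid n (east_counts p) ->
  core n (area_vector n p) = core n (fold_area n (east_counts p)).
Proof.
move=> n2 v; have n1 : (1 < n)%N by lia.
rewrite area_vectorE // /fold_area; set pi := east_counts p.
have tb := top_entry_bounds n1 v; have [_ bd] := valid_nth v.
transitivity (core n ((nth 0%N pi 0)%:Z :: rcons (mid_entries n pi) (area_entry n p n))).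
  have [->|->] : area_entry n p 1 = (nth 0%N pi 0)%:Z \/
      area_entry n p 1 = - (nth 0%N pi 0)%:Z.
    by rewrite area_entry1 -/pi; case: (sgn_path_cases p) => ->; case: ifP; lia.
  - by [].
  by rewrite /core sweep_oppl.
rewrite -!rcons_cons; have [->//|->] := area_entry_last p n2.
by apply: sweep_flip; have := bd n.-2; lia.
Qed.

(** The two area vectors can differ only in the sign of their nonzero first entry; the factor
    depending on n mod 4 is common to both. *)
Lemma odd_npos_area n p p' : (2 < n)%N -> east_counts p = east_counts p' ->
    (0 < nth 0 (east_counts p) 0)%N ->
  (odd (npos (area_vector n p)) == odd (npos (area_vector n p'))) =
  (sgn_path p == sgn_path p').
Proof.
move=> n2 e pos; rewrite !area_vectorE // -e (@area_entry_last_counts n p' p) ?e //; last by lia.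
rewrite /npos /= !oddD !area_entry1 -e; move: (odd (count _ _)) => b.
set x := (nth _ _ _)%:Z; have xp : 0 < x by lia.
have [hx hx'] : (0 < x) = true /\ (0 < - x) = false by split; lia.
by case: (sgn_path_cases p) => ->; case: (sgn_path_cases p') => ->; case: ifP => _;
  rewrite ?mulN1r ?mul1r ?opprK ?hx ?hx'; case: b.
Qed.

End Area.

(** * Signs and the bijection *)

Lemma marked_head w : unsigned w -> 0 < count is_north w ->
  marked (pred1 0) w = (0 < nth 0 (east_counts w) 0).
Proof.
case: w => // x w /andP[]; rewrite !inE east_counts_cons => /orP[]/eqP-> _ /= c.
  by apply/markedP => -[i [_ /eqP->]].
by rewrite (nth_map 0) ?size_east_counts.
Qed.

Lemma valid_east_counts n w : 0 < n -> lattice_word n w -> valid n (east_counts w).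
Proof.
move=> n0 /and3P[u /eqP cn /eqP ce]; apply/and3P; split.
- exact: sorted_east_counts.
- by rewrite size_east_counts cn.
have := all_east_counts w; rewrite ce; apply: sub_all => k /=; lia.
Qed.

Definition zeta_sign n p : step :=
  if odd (npos (area_vector n p)) then EastMinus else EastPlus.

Lemma is_sign_zeta n p : is_sign (zeta_sign n p).
Proof. by rewrite /zeta_sign; case: ifP. Qed.

Lemma zetaD_core n p : 2 < n -> valid n (east_counts p) ->
  let w := core n (fold_area n (east_counts p)) in
  [/\ zetaD n p = replace_east (after_north n w) (zeta_sign n p) w,
      ballot_word (2 * n - 1) w
    & marked (after_north n w) w = (0 < nth 0 (east_counts p) 0)].
Proof.
move=> n2 v w; have n1 : 1 < n by lia.
have sz := size_fold_area (east_counts p) n1.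
have b := bounded_fold n1 v; have nm := normal_fold n1 v; split.
- by rewrite /zetaD -/(core _ _) core_area.
- by apply: ballot_core => //; lia.
by rewrite /w marked_core //; lia.
Qed.

Lemma sgn_path_replace s w : unsigned w -> is_sign s ->
  sgn_path (replace_east (pred1 0) s w) =
  (if marked (pred1 0) w && (s == EastMinus) then -1 else 1)%R.
Proof. by move=> u hs; rewrite /sgn_path sign_replace // eq_sym. Qed.

Theorem theorem5p23 (n : nat) (hn : 3 <= n) :
  set_bij (signed_lattice_paths n) (signed_ballot_paths n) (zetaD n).
Proof.
have n0 : 0 < n by lia.
have n1 : 1 < n by lia.
split.
- move=> p [w [s [lw hs ->]]].
  have := @zetaD_core n (replace_east (pred1 0) s w) hn.
  rewrite east_counts_replace // => /(_ (valid_east_counts n0 lw))[-> bw _].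
  by exists (core n (fold_area n (east_counts w))), (zeta_sign n (replace_east (pred1 0) s w));
    split => //; exact: is_sign_zeta.
- move=> p p' /set_mem[w [s [lw hs ep]]] /set_mem[w' [s' [lw' hs' ep']]] e.
  have v := valid_east_counts n0 lw; have v' := valid_east_counts n0 lw'.
  have ec : east_counts p = east_counts w by rewrite ep east_counts_replace.
  have ec' : east_counts p' = east_counts w' by rewrite ep' east_counts_replace.
  have := @zetaD_core n p hn; have := @zetaD_core n p' hn; rewrite ec ec'.
  move=> /(_ v')[z' bw' _] /(_ v)[z bw mk].
  have /and3P[u /eqP cn /eqP ce] := lw; have /and3P[u' /eqP cn' /eqP ce'] := lw'.
  have /and3P[bu _ _] := bw; have /and3P[bu' _ _] := bw'.
  (* Erasing the sign from the common image leaves the core word, which determines the East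
     counts. *)
  have epi : east_counts w = east_counts w'.
    apply: (core_fold_inj n1 v v').
    rewrite -(map_unsign_replace (after_north n (core n (fold_area n (east_counts w)))) bu (is_sign_zeta n p)).
    by rewrite -z e z' map_unsign_replace // is_sign_zeta.
  have eww : w = w' by apply: east_counts_inj; rewrite ?ce.
  rewrite -eww in z'.
  (* If pi_1 = 0 the path starts with N and carries no sign; otherwise the sign in the image gives
     back the sign of the path. *)
  case: (posnP (nth 0 (east_counts w) 0)) => pos.
    by rewrite ep ep' -eww !replace_unmarked // marked_head ?cn ?pos.
  rewrite pos in mk.
  have es : zeta_sign n p = zeta_sign n p'.
    apply: (replace_inj bu _ _ mk); rewrite ?is_sign_zeta //.
    by rewrite -z -z'.
  have : sgn_path p == sgn_path p'.
    rewrite -(odd_npos_area hn) ?ec ?ec' ?eww //; last by rewrite -eww.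
    by move: es; rewrite /zeta_sign; do 2!case: odd.
  rewrite ep ep' -eww !sgn_path_replace // marked_head ?cn // pos /=.
  by move: hs hs'; case: (s) => //; case: (s').
move=> q [w [s [bw hs ->]]].
have [pi v ew] := core_fold_surj n1 bw.
have /and3P[so /eqP sz al] := v.
have al' : all (fun k => k <= n.-1) pi by apply: sub_all al => k; lia.
have [u [hu cn ce ec]] := east_counts_surj so al'.
have lu : lattice_word n u by rewrite /lattice_word hu cn ce sz !eqxx.
pose P t := replace_east (pred1 0) t u.
have ecP t : is_sign t -> east_counts (P t) = pi.
  by move=> ht; rewrite east_counts_replace.
have Z t : is_sign t -> [/\ zetaD n (P t) = replace_east (after_north n w) (zeta_sign n (P t)) w
    & marked (after_north n w) w = (0 < nth 0 pi 0)].
  by move=> ht; have := @zetaD_core n (P t) hn; rewrite ecP // ew => /(_ v)[].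
have inL t : is_sign t -> signed_lattice_paths n (P t) by move=> ht; exists u, t.
have [zp mk] := Z EastPlus isT; have [zm _] := Z EastMinus isT.
case: (posnP (nth 0 pi 0)) => pos.
  exists (P EastPlus); first exact: inL.
  by rewrite zp !replace_unmarked // mk pos.
(* The two signings of u produce different signs in the image, so one of them produces s. *)
have ne : zeta_sign n (P EastPlus) != zeta_sign n (P EastMinus).
  have := @odd_npos_area n (P EastPlus) (P EastMinus) hn.
  rewrite !ecP // pos => /(_ erefl isT).
  rewrite !sgn_path_replace // marked_head ?cn ?sz // ec pos /= /zeta_sign.
  by do 2!case: odd.
have [es|es] : s = zeta_sign n (P EastPlus) \/ s = zeta_sign n (P EastMinus).
  move: ne (is_sign_zeta n (P EastPlus)) (is_sign_zeta n (P EastMinus)).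
  by case: zeta_sign; case: zeta_sign => //; case: s hs; auto.
- by exists (P EastPlus); [exact: inL | rewrite zp es].
by exists (P EastMinus); [exact: inL | rewrite zm es].
Qed.
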